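(* Let $\mathcal{A}_1,\dots,\mathcal{A}_k$ be affine arrangements in vector spaces $V_1,\dots,V_k$ such that each cone $\mathbf{c}\mathcal{A}_i$ is free. Then the cone $\mathbf{c}(\mathcal{A}_1\oplus\cdots\oplus\mathcal{A}_k)$ is free.
   Context: An affine arrangement $\mathcal{A}$ in $V$ is a finite set of affine hyperplanes $\{v:\alpha(v)=c\}$ ($\alpha\in V^*\setminus\{0\}$, $c$ a scalar). Its cone $\mathbf{c}\mathcal{A}$ is the central arrangement in $\mathbb{K}\times V$ (coordinates $(x_0,v)$) consisting of the hyperplanes $\{\alpha(v)-cx_0=0\}$ for each affine hyperplane $\{\alpha=c\}\in\mathcal{A}$, together with $\{x_0=0\}$. The direct sum $\mathcal{A}_1\oplus\cdots\oplus\mathcal{A}_k$ is the affine arrangement in $V_1\times\cdots\times V_k$ consisting of $V_1\times\cdots\times H\times\cdots\times V_k$ for $H\in\mathcal{A}_i$, $i=1,\dots,k$. A central arrangement is free if its module of logarithmic vector fields $D=\{\delta\in\mathrm{Der}:\delta(\alpha_H)\in\alpha_HS\ \forall H\}$ is a free module over the polynomial ring $S$. *)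

(* Defs.v *)
From HB Require Import structures.
From mathcomp Require Import all_boot all_order all_algebra.
From mathcomp Require Import mpoly.
Set Implicit Arguments. Unset Strict Implicit. Unset Printing Implicit Defensive.
Import GRing.Theory.
Local Open Scope ring_scope.

(* Coordinates of a finite-dimensional K-vector space V are indexed by a
   finType [T], i.e. V = K^T.  The polynomial ring S of K^T is
   {mpoly K[#|T|]}, the variable for coordinate [j : T] being 'X_(enum_rank j). *)

Section Arr.
Variable K : fieldType.

Definition polyring (T : finType) := {mpoly K[#|T|]}.

Definition coordX (T : finType) (j : T) : polyring T := 'X_(enum_rank j).

(* An affine hyperplane {v : alpha(v) = c}, given by the coefficient vector
   of alpha in V^* and the scalar c. *)
Definition affHyp (T : finType) := ({ffun T -> K} * K)%type.
Definition ah_form (T : finType) (H : affHyp T) : {ffun T -> K} := H.1.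
Definition ah_const (T : finType) (H : affHyp T) : K := H.2.
Definition AffHyp (T : finType) (a : {ffun T -> K}) (c : K) : affHyp T := (a, c).

(* A (central) linear hyperplane {alpha = 0} is given by its form. *)
Definition centralArr (T : finType) := seq {ffun T -> K}.
Definition affArr (T : finType) := seq (affHyp T).

Definition wf_affArr (T : finType) (A : affArr T) :=
  forall H, H \in A -> ah_form H != 0.

Definition linpoly (T : finType) (a : {ffun T -> K}) : polyring T :=
  \sum_(j : T) a j *: coordX j.

(* A derivation of S: theta = sum_j theta_j d/dx_j *)
Definition der (T : finType) := {ffun T -> polyring T}.

Definition der_apply (T : finType) (theta : der T) (f : polyring T) : polyring T :=
  \sum_(j : T) theta j * mderiv (enum_rank j) f.

Definition logder (T : finType) (A : centralArr T) (theta : der T) : Prop :=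
  forall a, a \in A -> exists g : polyring T, der_apply theta (linpoly a) = linpoly a * g.

Definition der_comb (T : finType) (m : nat) (B : 'I_m -> der T)
  (c : 'I_m -> polyring T) : der T :=
  \sum_(i < m) [ffun j => c i * B i j].

(* D(A) is a free S-module: it has a (necessarily finite) basis. *)
Definition free_arr (T : finType) (A : centralArr T) : Prop :=
  exists (m : nat) (B : 'I_m -> der T),
    [/\ forall i, logder A (B i),
        forall theta, logder A theta -> exists c, theta = der_comb B c
      & forall c, der_comb B c = 0 -> forall i, c i = 0].

(* The cone: coordinates option T, with None the new coordinate x_0.
   {alpha = c} |-> {alpha(v) - c x_0 = 0}, plus {x_0 = 0}. *)
Definition coneForm (T : finType) (H : affHyp T) : {ffun option T -> K} :=
  [ffun j => match j with None => - ah_const H | Some j' => ah_form H j' end].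

Definition x0Form (T : finType) : {ffun option T -> K} :=
  [ffun j => if j is None then 1 else 0].

Definition cone (T : finType) (A : affArr T) : centralArr (option T) :=
  x0Form T :: map (@coneForm T) A.

(* Direct sum of the family (A_i)_{i : I} of affine arrangements in K^(T i):
   the ambient space is the product K^{sum_i T i} with coordinates {i : I & T i};
   each H in A_i gives V_1 x ... x H x ... x V_k. *)
Definition liftForm (I : finType) (T : I -> finType) (i : I) (a : {ffun T i -> K})
  (p : {i : I & T i}) : K :=
  match eqVneq (tag p) i return K with
  | EqNotNeq e => a (ecast k (T k) e (tagged p))
  | NeqNotEq _ => 0
  end.

Definition liftHyp (I : finType) (T : I -> finType) (i : I) (H : affHyp (T i))
  : affHyp {i : I & T i} :=
  @AffHyp {i : I & T i} (finfun (liftForm (ah_form H))) (ah_const H).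

Definition dirsum (I : finType) (T : I -> finType) (A : forall i, affArr (T i))
  : affArr {i : I & T i} :=
  flatten [seq map (@liftHyp I T i) (A i) | i <- enum I].

End Arr.

(* Main.v *)
(**
Write [D_0(cA)] for the derivations in [D(cA)] that annihilate [x_0].
Subtracting multiples of the Euler derivation shows [D(cA) = S theta_E + D_0(cA)],
a direct sum, so it is enough to know that freeness of [D(cA)] implies, and is
implied by, freeness of [D_0(cA)].  For the nontrivial direction, graded Nakayama
turns a basis of [D(cA)] into a homogeneous one; writing [psi_i(x_0) = x_0 g_i],
the [g_i] generate the unit ideal, hence some [g_i] is a nonzero constant and
[psi_i] can be used to eliminate [x_0] from the other basis elements.  Finally
[D_0] of the cone of a direct sum is the direct sum of the [D_0(cA_i)], each
extended to the larger polynomial ring, and this extension preserves bases because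
the larger ring is free over the smaller one.
*)
Require Import Defs.
From HB Require Import structures.
From mathcomp Require Import all_boot all_order all_algebra.
From mathcomp Require Import mpoly.
Set Implicit Arguments. Unset Strict Implicit. Unset Printing Implicit Defensive.
Import GRing.Theory.
Local Open Scope ring_scope.

(** * Bases of modules of vectors over a commutative ring *)

Definition spans (S : comNzRingType) (J : Type) (I : finType) (B : I -> J -> S)
    (theta : J -> S) : Prop :=
  exists c : I -> S, forall j, theta j = \sum_i c i * B i j.

(** Vectors are plain functions compared pointwise, and any [finType] may index a basis, so that
    [option] and sigma types can serve as index sets later. *)
Definition module_basis (S : comNzRingType) (J : Type) (D : (J -> S) -> Prop)
    (I : finType) (B : I -> J -> S) : Prop :=
  [/\ forall i, D (B i),
      forall theta, D theta -> spans B theta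
    & forall c : I -> S, (forall j, \sum_i c i * B i j = 0) -> forall i, c i = 0].

Section Spans.
Variables (S : comNzRingType) (J : Type) (I : finType) (B : I -> J -> S).

Lemma eq_spans (u v : J -> S) : u =1 v -> spans B u -> spans B v.
Proof. by move=> uv [c hc]; exists c => j; rewrite -uv. Qed.

Lemma spans_sum (L : Type) (r : seq L) (P : pred L) (u : L -> J -> S)
    (a : L -> S) :
  (forall l, P l -> spans B (u l)) ->
  spans B (fun j => \sum_(l <- r | P l) a l * u l j).
Proof.
move=> h; elim: r => [|l r [c hc]].
  by exists (fun=> 0) => j; rewrite big_nil big1 // => i _; rewrite mul0r.
case Pl: (P l); last by exists c => j; rewrite big_cons Pl.
have [b hb] := h l Pl.
exists (fun i => a l * b i + c i) => j; rewrite big_cons Pl hc hb mulr_sumr.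
by rewrite -big_split; apply: eq_bigr => i _; rewrite mulrDl mulrA.
Qed.

End Spans.

(** * Homogeneous components and homogeneous bases *)

Lemma pihomogXM (K : fieldType) n d (m : 'X_{1..n}) (p : {mpoly K[n]}) :
  pihomog mdeg d ('X_[m] * p) =
  if (mdeg m <= d)%N then 'X_[m] * pihomog mdeg (d - mdeg m) p else 0.
Proof.
elim/mpolyind: p => [|c k p _ _ IHp].
  by rewrite mulr0 !pihomog0 mulr0; case: ifP.
rewrite mulrDr !pihomogD IHp -scalerAr !linearZ /= -mpolyXD !pihomogX /= mdegD.
have [le_md|lt_dm] := leqP (mdeg m) d; last first.
  case: eqP => [e|_]; last by rewrite scaler0 addr0.
  by rewrite -e ltnNge leq_addr in lt_dm.
rewrite -(eqn_add2l (mdeg m) (mdeg k)) subnKC // mulrDr -scalerAr.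
by congr (_ *: _ + _); case: eqP; rewrite ?mpolyXD ?mulr0.
Qed.

(* Graded Nakayama: homogeneous components of the given basis whose coordinate
   vectors at the origin form a basis of [K^m] generate the whole module. *)
Lemma homog_basis (K : fieldType) n (J : finType)
    (D : (J -> {mpoly K[n]}) -> Prop) m (B : 'I_m -> J -> {mpoly K[n]}) :
  module_basis D B ->
  (forall d theta, D theta -> D (fun j => pihomog mdeg d (theta j))) ->
  exists (P : 'I_m -> J -> {mpoly K[n]}) (d : 'I_m -> nat),
    module_basis D P /\ forall i j, P i j \is (d i).-homog.
Proof.
move=> [DB spanB freeB] Dhom.
pose M := (\max_i \max_j (msize (B i j)))%N.
have leM i j : (msize (B i j) <= M)%N.
  by apply: leq_trans (leq_bigmax (F := fun i => \max_j msize (B i j)) i);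
     apply: (leq_bigmax (F := fun j => msize (B i j))).
have BE i j : B i j = \sum_(d < M) pihomog mdeg d (B i j).
  by apply: pihomog_partitionE.
have [C hC] : exists C : 'I_m * 'I_M -> 'I_m -> {mpoly K[n]}, forall (q : 'I_m * 'I_M) j,
    pihomog mdeg q.2 (B q.1 j) = \sum_l C q l * B l j.
  have /fin_all_exists : forall q : 'I_m * 'I_M, spans B
      (fun j => pihomog mdeg q.2 (B q.1 j)) by move=> q; exact/spanB/Dhom/DB.
  by [].
(* The components of [B i] add up to [B i], and coordinates in a basis are unique. *)
have sumC i l : \sum_d C (i, d) l = (l == i)%:R.
  apply/eqP; rewrite -subr_eq0; apply/eqP; move: l.
  apply: freeB => j; under eq_bigr do rewrite mulrBl mulr_suml.
  rewrite sumrB exchange_big /= (bigD1 i) //= eqxx mul1r.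
  rewrite [X in _ - (_ + X)]big1 ?addr0; last first.
    by move=> l /negbTE->; rewrite mul0r.
  rewrite [X in _ - X]BE -sumrB big1 // => d _.
  by rewrite -(hC (i, d)) subrr.
(* The rows are the coordinate vectors, evaluated at the origin, of all homogeneous components of
   the basis. Those belonging to [B i] sum to the [i]-th unit vector, so the rank is full and [f]
   can select [m] independent rows. *)
pose CM : 'M[K]_(#|{: 'I_m * 'I_M}|, m) := \matrix_(r, l) (C (enum_val r) l)@_0%MM.
have fullC : row_full CM.
  rewrite -sub1mx; apply/row_subP => i.
  suff -> : row i 1%:M = \sum_d row (enum_rank (i, d)) CM.
    by apply: summx_sub => d _; apply: row_sub.
  apply/rowP => l; rewrite summxE !mxE.
  under eq_bigr do rewrite !mxE enum_rankK.
  rewrite -raddf_sum sumC /= eq_sym; case: eqP => _; last by rewrite mcoeff0.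
  by rewrite mcoeff1 eqxx.
pose f (i : 'I_m) : 'I_m * 'I_M := enum_val (fullrankfun fullC i).
pose P i j := pihomog mdeg (f i).2 (B (f i).1 j).
have PE i j : P i j = \sum_l C (f i) l * B l j by apply: hC.
pose Q : 'M[K]_m := \matrix_(i, l) (C (f i) l)@_0%MM.
have uQ : Q \in unitmx.
  suff -> : Q = rowsub (fullrankfun fullC) CM by apply: fullrowsub_unit.
  by apply/matrixP => i l; rewrite !mxE.
(* Strong induction on the degree. The scalars [v] match the constant terms of the coordinates [c],
   so the remainder [e] has none; its contribution in degree [d] then involves only components of
   the [B l] of degree below [d]. *)
have spanP d theta : D theta -> spans P (fun j => pihomog mdeg d (theta j)).
  elim/ltn_ind: d theta => d IHd theta Dtheta.
  have [c hc] := spanB _ Dtheta.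
  pose v : 'rV[K]_m := (\row_l (c l)@_0%MM) *m invmx Q.
  pose e l := c l - \sum_i v 0 i *: C (f i) l.
  have e0 l : (e l)@_0%MM = 0.
    rewrite mcoeffB raddf_sum /=; apply/eqP; rewrite subr_eq0; apply/eqP.
    have /rowP/(_ l) : v *m Q = \row_l (c l)@_0%MM by rewrite mulmxKV.
    by rewrite !mxE => <-; apply: eq_bigr => i _; rewrite mcoeffZ !mxE.
  have thetaE j : pihomog mdeg d (theta j) =
      \sum_i ((v 0 i)%:MP *+ (d == (f i).2)) * P i j
    + \sum_l (1 : {mpoly K[n]}) * \sum_(k <- msupp (e l) | (0 < mdeg k <= d)%N)
        ((e l)@_k *: 'X_[k]) * pihomog mdeg (d - mdeg k) (B l j).
    have -> : theta j = \sum_i v 0 i *: P i j + \sum_l e l * B l j.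
      rewrite hc; under [X in X + _]eq_bigr do rewrite PE scaler_sumr.
      rewrite exchange_big -big_split; apply: eq_bigr => l _ /=.
      under eq_bigr do rewrite scalerAl.
      by rewrite mulrBl mulr_suml addrC subrK.
    rewrite pihomogD !raddf_sum; congr (_ + _); apply: eq_bigr => i _ /=.
      rewrite linearZ /= mulrnAl mul_mpolyC; case: eqP => [->|ne].
        by rewrite pihomog_id mulr1n.
      by rewrite (pihomog_ne0 (d := (f i).2)) ?scaler0 ?pihomogP // eq_sym; apply/eqP.
    rewrite mul1r {1}[e i]mpolyE mulr_suml raddf_sum /= [RHS]big_mkcond /=.
    apply: eq_big_seq => k k_e; rewrite -scalerAl linearZ /= pihomogXM lt0n.
    rewrite mdeg_eq0; case: eqP k_e => [->|_ _ /=].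
      by rewrite mcoeff_msupp e0 eqxx.
    by case: ifP => _; rewrite ?scaler0 // scalerAl.
  have [b hb] : spans P (fun j => \sum_l 1 *
      \sum_(k <- msupp (e l) | (0 < mdeg k <= d)%N)
        ((e l)@_k *: 'X_[k]) * pihomog mdeg (d - mdeg k) (B l j)).
    apply: spans_sum => l _; apply: spans_sum => k /andP[k0 kd].
    by apply: IHd; rewrite ?ltn_subrL ?k0 ?(leq_trans k0 kd).
  exists (fun i => (v 0 i)%:MP *+ (d == (f i).2) + b i) => j.
  by rewrite thetaE hb -big_split; apply: eq_bigr => i _; rewrite mulrDl.
have spanPD theta : D theta -> spans P theta.
  move=> Dtheta; pose N := (\max_j (msize (theta j)))%N.
  apply: (@eq_spans _ _ _ _ (fun j => \sum_(d < N) 1 * pihomog mdeg d (theta j))).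
    move=> j; under eq_bigr do rewrite mul1r.
    rewrite -pihomog_partitionE //.
    exact: (leq_bigmax (F := fun j => msize (theta j))).
  by apply: spans_sum => d _; apply: spanP.
exists P, (fun i => (f i).2 : nat); split; last by move=> i j; apply: pihomogP.
split=> [i|//|c hc]; first exact/Dhom/DB.
(* [P] and [B] generate each other, and [RM *m PM = 1] by freeness of [B]. A one-sided inverse of a
   square matrix over a commutative ring is two-sided, so a relation among the [P i], pushed through
   [PM], must be trivial. *)
have [R hR] : exists R : 'I_m -> 'I_m -> {mpoly K[n]}, forall i j,
    B i j = \sum_l R i l * P l j.
  have /fin_all_exists : forall i, spans P (B i) by move=> i; exact/spanPD/DB.
  by [].
pose RM : 'M_m := \matrix_(i, l) R i l.
pose PM : 'M_m := \matrix_(i, l) C (f i) l.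
have assoc (a : 'rV_m) j : \sum_i a 0 i * P i j = \sum_l (a *m PM) 0 l * B l j.
  under eq_bigr do rewrite PE mulr_sumr.
  rewrite exchange_big; apply: eq_bigr => l _; rewrite mxE mulr_suml.
  by apply: eq_bigr => i _; rewrite mxE mulrA.
have RP : RM *m PM = 1%:M.
  apply/row_matrixP => i; rewrite row_mul.
  apply/rowP => l; apply/eqP; rewrite -subr_eq0; apply/eqP; move: l.
  apply: freeB => j; under eq_bigr do rewrite mulrBl.
  rewrite sumrB -assoc; under eq_bigr do rewrite !mxE.
  rewrite -hR (bigD1 i) //= !mxE eqxx mul1r big1 ?addr0 ?subrr // => l.
  by rewrite !mxE eq_sym => /negbTE->; rewrite mul0r.
have cP : (\row_i c i) *m PM = 0.
  apply/rowP => l; rewrite [RHS]mxE; move: l; apply: freeB => j.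
  by rewrite -assoc; under eq_bigr do rewrite mxE.
move=> i; have /rowP/(_ i) : \row_i c i = 0.
  by rewrite -[LHS]mulmx1 -(mulmx1C RP) mulmxA cP mul0mx.
by rewrite !mxE.
Qed.

(** * Extension of the polynomial ring by further variables *)

Lemma eq_mpoly_rmorph (R : nzRingType) n (S : nzRingType)
    (f g : {rmorphism {mpoly R[n]} -> S}) :
  (forall c, f c%:MP = g c%:MP) -> (forall i, f 'X_i = g 'X_i) -> f =1 g.
Proof.
move=> fgC fgX p; rewrite [p]mpolyE !rmorph_sum; apply: eq_bigr => m _.
rewrite -mul_mpolyC !rmorphM /= fgC; congr (_ * _).
rewrite mpolyXE_id !rmorph_prod; apply: eq_bigr => i _.
by rewrite !rmorphXn /= fgX.
Qed.

(** A common form of D(cA) and D_0(cA). The coefficients [a] and the divisor [l] are separate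
    because in D_0 the form contracted with [theta] loses its x_0 term while the divisor keeps
    it. *)
Definition log_along (K : fieldType) n (J : finType) (X : eqType) (A : seq X)
    (a : X -> J -> K) (l : X -> {mpoly K[n]}) (theta : J -> {mpoly K[n]}) : Prop :=
  forall H, H \in A -> exists g, \sum_j a H j *: theta j = l H * g.

Section BaseChange.
Variables (K : fieldType) (n N : nat) (s : 'I_n -> 'I_N).
Hypothesis s_inj : injective s.

Definition mrename : {mpoly K[n]} -> {mpoly K[N]} :=
  mmap (@mpolyC N K) (fun i => 'X_(s i)).

HB.instance Definition _ := GRing.RMorphism.on mrename.

Lemma mrenameC c : mrename c%:MP = c%:MP.
Proof. exact: mmapC. Qed.

Lemma mrenameX i : mrename 'X_i = 'X_(s i).
Proof. by rewrite /mrename mmapX mmap1U. Qed.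

Lemma mrenameZ c p : mrename (c *: p) = c *: mrename p.
Proof. by rewrite -!mul_mpolyC rmorphM /= mrenameC. Qed.

(* [msplit] regards a polynomial as one in the variables outside the image of
   [s], with coefficients in the polynomial ring on the others, which exhibits
   the target of [mrename] as a free module over its source. *)
Definition msplit_var (k : 'I_N) : {mpoly {mpoly K[n]}[N]} :=
  if [pick i | s i == k] is Some i then ('X_i)%:MP else 'X_k.

Definition msplit : {mpoly K[N]} -> {mpoly {mpoly K[n]}[N]} :=
  mmap (@mpolyC N {mpoly K[n]} \o @mpolyC n K) msplit_var.

HB.instance Definition _ := GRing.RMorphism.on msplit.

Definition mjoin : {mpoly {mpoly K[n]}[N]} -> {mpoly K[N]} :=
  mmap mrename (fun k => 'X_k).

HB.instance Definition _ := GRing.RMorphism.on mjoin.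

Lemma msplitK p : mjoin (msplit p) = p.
Proof.
apply: (eq_mpoly_rmorph (f := mjoin \o msplit) (g := idfun)) => [c|k] /=.
  by rewrite /msplit mmapC /= /mjoin mmapC /= mrenameC.
rewrite /msplit mmapX mmap1U /msplit_var; case: pickP => [i /eqP <-|_].
  by rewrite /mjoin mmapC /= mrenameX.
by rewrite /mjoin mmapX mmap1U.
Qed.

Lemma msplit_rename p : msplit (mrename p) = p%:MP.
Proof.
apply: (eq_mpoly_rmorph (f := msplit \o mrename) (g := @mpolyC N {mpoly K[n]}))
  => [c|i] /=.
  by rewrite mrenameC /msplit mmapC.
rewrite mrenameX /msplit mmapX mmap1U /msplit_var.
by case: pickP => [j /eqP /s_inj -> //|/(_ i)]; rewrite eqxx.
Qed.

Lemma msplitZ c p : msplit (c *: p) = c%:MP *: msplit p.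
Proof. by rewrite /msplit mmapZ /= mul_mpolyC. Qed.

(** The coefficients [a] are scalars and the divisors come from the smaller ring, so membership,
    spanning and independence can all be tested on each coefficient of [msplit] separately. *)
Lemma base_change_basis (J : finType) (X : eqType) (A : seq X)
    (a : X -> J -> K) (l : X -> {mpoly K[n]}) (L : finType)
    (B : L -> J -> {mpoly K[n]}) :
  module_basis (log_along A a l) B ->
  module_basis (log_along A a (mrename \o l)) (fun i j => mrename (B i j)).
Proof.
move=> [DB spanB freeB]; split=> [i H HA|theta Dtheta|c hc i].
- have [g hg] := DB i H HA; exists (mrename g); rewrite /= -rmorphM -hg.
  by rewrite rmorph_sum; apply: eq_bigr => j _; rewrite /= mrenameZ.
- have spanm m : spans (fun i j => mrename (B i j))
      (fun j => mrename (msplit (theta j))@_m).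
    (* The divisor becomes a constant under [msplit], so taking the coefficient at [m] preserves
       divisibility by it. *)
    have [|c hc] := spanB (fun j => (msplit (theta j))@_m).
      move=> H HA; have [g hg] := Dtheta H HA; exists (msplit g)@_m.
      have /(congr1 (mcoeff m)) := congr1 msplit hg.
      rewrite /= rmorphM /= msplit_rename mcoeffCM => <-.
      rewrite (rmorph_sum msplit) (raddf_sum (mcoeff m)); apply: eq_bigr => j _ /=.
      by rewrite msplitZ mcoeffZ mul_mpolyC.
    exists (mrename \o c) => j; rewrite hc rmorph_sum.
    by apply: eq_bigr => i _; rewrite rmorphM.
  pose M := (\max_j msize (msplit (theta j)))%N.
  have thetaE j : \sum_(m : 'X_{1..N < M}) 'X_[m] * mrename (msplit (theta j))@_m
      = theta j.
    rewrite -[RHS]msplitK /mjoin (mmapE M); last first.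
      exact: (leq_bigmax (F := fun j => msize (msplit (theta j)))).
    by apply: eq_bigr => m _; rewrite mmap1_id mulrC.
  by apply: eq_spans thetaE _; apply: spans_sum => m _; apply: spanm.
- rewrite -[c i]msplitK [msplit (c i)](_ : _ = 0) ?/mjoin ?mmap0 //.
  apply/mpolyP => m; rewrite mcoeff0; move: i.
  apply: freeB => j; have /(congr1 (mcoeff m)) := congr1 msplit (hc j).
  rewrite rmorph0 mcoeff0 (rmorph_sum msplit) (raddf_sum (mcoeff m)) => h.
  rewrite -[RHS]h; apply: eq_bigr => i _ /=.
  by rewrite rmorphM /= msplit_rename [in RHS]mulrC mcoeffCM mulrC.
Qed.

End BaseChange.

(** * Derivations as coefficient vectors *)

Lemma big_option (R : nmodType) (T : finType) (F : option T -> R) :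
  \sum_j F j = F None + \sum_t F (Some t).
Proof.
rewrite (bigD1 None) //=; congr (_ + _).
rewrite (reindex_omap Some id) /=; last by case.
by apply: eq_bigl => t; rewrite eqxx.
Qed.

Lemma coordX_neq0 (K : fieldType) (T : finType) (j : T) : coordX K j != 0.
Proof.
apply/eqP => /(congr1 (mcoeff U_(enum_rank j)%MM)).
by rewrite mcoeffX eqxx mcoeff0 => /eqP; rewrite oner_eq0.
Qed.

(** The partial derivatives of a linear form are its coefficients; this removes differentiation from
    the rest of the argument. *)
Lemma der_apply_linpoly (K : fieldType) (T : finType) (theta : der K T)
    (a : {ffun T -> K}) :
  der_apply theta (linpoly a) = \sum_j a j *: theta j.
Proof.
apply: eq_bigr => j _; rewrite /linpoly raddf_sum (bigD1 j) //= big1 => [|i ij].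
  rewrite mderivZ /coordX mderivX mnm1E eqxx scale1r addr0.
  rewrite -{1}[U_(_)%MM]add0m addmK mpolyX0.
  by rewrite -scalerAr mulr1.
rewrite mderivZ /coordX mderivX mnm1E (inj_eq enum_rank_inj) (negbTE ij).
by rewrite scale0r scaler0.
Qed.

Lemma logderE (K : fieldType) (T : finType) (A : centralArr K T) (theta : der K T) :
  logder A theta <-> log_along A (fun a => a) (@linpoly K T) theta.
Proof.
by split=> h a /h[g]; rewrite ?der_apply_linpoly => hg; exists g;
   rewrite ?der_apply_linpoly.
Qed.

Lemma der_combE (K : fieldType) (T : finType) m (B : 'I_m -> der K T) c j :
  der_comb B c j = \sum_i c i * B i j.
Proof. by rewrite sum_ffunE; apply: eq_bigr => i _; rewrite ffunE. Qed.

Lemma free_arr_basis (K : fieldType) (T : finType) (A : centralArr K T) :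
  free_arr A -> exists m (B : 'I_m -> T -> polyring K T),
    module_basis (log_along A (fun a => a) (@linpoly K T)) B.
Proof.
move=> [m [B [DB spanB freeB]]].
exists m, (fun i => B i); split=> [i|theta Dtheta|c hc].
- exact/logderE.
- have [|c hc] := spanB (finfun theta).
    apply/logderE => a aA; have [g hg] := Dtheta a aA; exists g.
    by under eq_bigr do rewrite ffunE.
  by exists c => j; rewrite -der_combE -hc ffunE.
- by apply: freeB; apply/ffunP => j; rewrite der_combE hc ffunE.
Qed.

Lemma basis_free_arr (K : fieldType) (T : finType) (A : centralArr K T)
    (L : finType) (B : L -> T -> polyring K T) :
  module_basis (log_along A (fun a => a) (@linpoly K T)) B -> free_arr A.
Proof.
move=> [DB spanB freeB].
exists #|L|, (fun i => finfun (B (enum_val i))); split=> [i|theta Dtheta|c hc].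
- apply/logderE => a aA; have [g hg] := DB (enum_val i) a aA; exists g.
  by under eq_bigr do rewrite ffunE.
- have [|c hc] := spanB theta; first exact/logderE.
  exists (c \o enum_val); apply/ffunP => j; rewrite der_combE hc.
  rewrite (reindex (@enum_val L L)) /=; last exact/onW_bij/enum_val_bij.
  by apply: eq_bigr => i _; rewrite ffunE.
- move=> i; rewrite -[i]enum_valK; move: (enum_val i).
  apply: (freeB (c \o enum_rank)) => j.
  rewrite (reindex (@enum_val L L)) /=; last exact/onW_bij/enum_val_bij.
  have /ffunP/(_ j) := hc; rewrite der_combE !ffunE => h; rewrite -[RHS]h.
  by apply: eq_bigr => k _; rewrite ffunE enum_valK.
Qed.

(** * Passage between D(cA) and D_0(cA) *)

Section Cone.
Variables (K : fieldType) (T : finType).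
Implicit Types (A : affArr K T) (theta : option T -> polyring K (option T)).

Definition log_cone A : (option T -> polyring K (option T)) -> Prop :=
  log_along (cone A) (fun a => a) (@linpoly K (option T)).

(* The derivations in [D(cA)] that annihilate [x_0], as vectors indexed by [T]. *)
Definition log_cone0 A : (T -> polyring K (option T)) -> Prop :=
  log_along A (fun H => @ah_form K T H) (fun H => linpoly (coneForm H)).

Let X0 : polyring K (option T) := coordX K None.

Lemma linpoly_x0 : linpoly (x0Form K T) = X0.
Proof.
rewrite /linpoly big_option ffunE scale1r big1 ?addr0 // => t _.
by rewrite ffunE scale0r.
Qed.

Lemma log_cone_x0 A theta : log_cone A theta -> exists g, theta None = X0 * g.
Proof.
move=> /(_ (x0Form K T)); rewrite inE eqxx => /(_ isT) [g].
rewrite linpoly_x0 big_option ffunE scale1r big1 ?addr0 => [hg|t _].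
  by exists g.
by rewrite ffunE scale0r.
Qed.

Lemma log_coneE A theta :
  theta None = 0 -> log_cone A theta <-> log_cone0 A (theta \o Some).
Proof.
move=> theta0.
have sumE H : \sum_j coneForm H j *: theta j
            = \sum_t ah_form H t *: theta (Some t).
  rewrite big_option theta0 scaler0 add0r.
  by apply: eq_bigr => t _; rewrite ffunE.
split=> [Dtheta H HA|Dtheta a].
  have [|g hg] := Dtheta (coneForm H); first by rewrite inE map_f ?orbT.
  by exists g; rewrite -hg sumE.
rewrite inE => /orP[/eqP->|/mapP[H HA ->]].
  exists 0; rewrite mulr0 big_option theta0 scaler0 add0r big1 // => t _.
  by rewrite ffunE scale0r.
by have [g hg] := Dtheta H HA; exists g; rewrite sumE.
Qed.

Lemma log_cone_euler A : log_cone A (@coordX K (option T)).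
Proof. by move=> a _; exists 1; rewrite mulr1. Qed.

Lemma log_coneB A theta1 theta2 g :
  log_cone A theta1 -> log_cone A theta2 ->
  log_cone A (fun j => theta1 j - g * theta2 j).
Proof.
move=> D1 D2 a aA; have [g1 h1] := D1 a aA; have [g2 h2] := D2 a aA.
exists (g1 - g * g2); rewrite mulrBr -h1 mulrCA -h2 mulr_sumr -sumrB.
by apply: eq_bigr => j _; rewrite scalerBr scalerAr.
Qed.

Lemma log_cone_pihomog A d theta :
  log_cone A theta -> log_cone A (fun j => pihomog mdeg d (theta j)).
Proof.
move=> Dtheta a aA; have [g hg] := Dtheta a aA.
(* A linear form raises degrees by one, so the quotient is the component of [g] in degree [d - 1],
   and zero when [d = 0]. *)
exists (if (0 < d)%N then pihomog mdeg d.-1 g else 0).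
have -> : \sum_j a j *: pihomog mdeg d (theta j)
        = pihomog mdeg d (\sum_j a j *: theta j).
  by rewrite raddf_sum; apply: eq_bigr => j _; rewrite /= linearZ.
rewrite hg /linpoly !mulr_suml raddf_sum; apply: eq_bigr => j _ /=.
rewrite -!scalerAl linearZ /= pihomogXM mdeg1 subn1.
by case: ifP; rewrite ?mulr0.
Qed.

Lemma log_cone0_extend A (theta : T -> polyring K (option T)) :
  log_cone0 A theta -> log_cone A (fun j => if j is Some t then theta t else 0).
Proof. by move=> h; apply/log_coneE. Qed.

Lemma log_cone0_basis A : free_arr (cone A) ->
  exists (L : finType) (B : L -> T -> polyring K (option T)),
    module_basis (log_cone0 A) B.
Proof.
move=> /free_arr_basis[m [B0 /homog_basis[d theta|P [d [[DP spanP freeP] homP]]]]].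
  exact: log_cone_pihomog.
have /fin_all_exists[g hg] : forall i, exists g, P i None = X0 * g.
  by move=> i; apply: log_cone_x0 (DP i).
have relE (c : 'I_m -> polyring K (option T)) p :
    X0 * p = \sum_i c i * P i None -> p = \sum_i c i * g i.
  move=> h; apply: (mulfI (coordX_neq0 K (@None T))); rewrite -/X0 h mulr_sumr.
  by apply: eq_bigr => i _; rewrite hg mulrCA.
(* If [c] are the coordinates of the Euler derivation, [\sum_i c_i g_i = 1]. *)
have [i0 gi0] : exists i0, (g i0)@_0%MM != 0.
  have [c hc] := spanP _ (@log_cone_euler A).
  have /relE : X0 * 1 = \sum_i c i * P i None by rewrite mulr1 -hc.
  move=> /(congr1 (mcoeff 0%MM)); rewrite mcoeff1 eqxx raddf_sum /= => h1.
  case: (pickP (fun i => (g i)@_0%MM != 0)) => [i gi|g0]; first by exists i.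
  move/eqP: h1; rewrite big1 ?oner_eq0 // => i _.
  by rewrite rmorphM /= (eqP (negbFE (g0 i))) mulr0.
set u := (g i0)@_0%MM in gi0.
(* [X0 * g i0] is homogeneous of degree [d i0], so all monomials of [g i0] have the same degree. As
   one of them is constant, [g i0] is the constant [u]. *)
have degP k : (g i0)@_k != 0 -> d i0 = (mdeg k).+1.
  move=> gk; have := homP i0 None; rewrite hg mulrC => /dhomogP /= h.
  rewrite -(h (U_(enum_rank None) + k)%MM); first by rewrite mdegD mdeg1.
  by rewrite mcoeff_msupp mcoeffMX.
have gE : g i0 = u%:MP.
  apply/mpolyP => k; rewrite mcoeffC; case: eqP => [->|/eqP k0].
    by rewrite mulr1.
  rewrite mulr0; apply/eqP/negPn/negP => /degP.
  rewrite (degP 0%MM gi0) mdeg0 => -[] /esym/eqP; rewrite mdeg_eq0.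
  by rewrite (negbTE k0).
(* [P i0] is spent on clearing the x_0 coordinate of the other basis elements, so the rank drops by
   one. *)
pose B (i : 'I_m.-1) (j : option T) :=
  P (lift i0 i) j - (u^-1 *: g (lift i0 i)) * P i0 j.
have BNone i : B i None = 0.
  rewrite /B !hg gE mulrCA -scalerAl [_ * u%:MP]mulrC mul_mpolyC scalerA.
  by rewrite mulVf // scale1r subrr.
exists 'I_m.-1, (fun i t => B i (Some t)); split=> [i|theta Dtheta|c hc i].
- by apply/(log_coneE _ (BNone i)); apply: log_coneB; apply: DP.
- have [c hc] := spanP _ (log_cone0_extend Dtheta).
  have /relE : X0 * 0 = \sum_i c i * P i None by rewrite mulr0 -hc.
  (* The vanishing x_0 coordinate determines the coefficient of [P i0] from the others; it is
     exactly the total correction hidden in the [B i]. *)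
  rewrite (bigD1_ord i0) //= gE mulrC mul_mpolyC => /esym/eqP.
  rewrite addr_eq0 => /eqP c0.
  exists (c \o lift i0) => t; rewrite (hc (Some t)) (bigD1_ord i0) //=.
  rewrite /B; under [in RHS]eq_bigr do rewrite mulrBr mulrA.
  rewrite sumrB addrC -mulr_suml; congr (_ + _); rewrite -mulNr; congr (_ * _).
  under eq_bigr do rewrite -scalerAr.
  by rewrite -scaler_sumr -scalerN -c0 scalerA mulVf // scale1r.
- have hB j : \sum_i c i * B i j = 0.
    by case: j => // ; rewrite big1 // => l _; rewrite BNone mulr0.
  (* A relation among the [B i] becomes one among the [P l], the coefficient at [i0] collecting the
     corrections. *)
  pose c' l := if unlift i0 l is Some i then c i
               else - \sum_i c i * (u^-1 *: g (lift i0 i)).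
  have <- : c' (lift i0 i) = c i by rewrite /c' liftK.
  apply: freeP => j; rewrite (bigD1_ord i0) //= /c' unlift_none.
  under eq_bigr do rewrite liftK.
  rewrite -[RHS](hB j) /B; under [in RHS]eq_bigr do rewrite mulrBr mulrA.
  by rewrite sumrB -mulr_suml mulNr addrC.
Qed.

(** The Euler derivation, at index [None], joins the basis of D_0. If [theta None = X0 * g],
    subtracting [g] times Euler lands in D_0; in a relation, the x_0 coordinate isolates the Euler
    coefficient. *)
Lemma cone_free_of_basis A (L : finType) (B : L -> T -> polyring K (option T)) :
  module_basis (log_cone0 A) B -> free_arr (cone A).
Proof.
move=> [DB spanB freeB].
pose E (l : option L) j := if l is Some i then
  (if j is Some t then B i t else 0) else coordX K (j : option T).
have sumE (c : option L -> polyring K (option T)) j : \sum_l c l * E l j =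
    c None * coordX K j + (if j is Some t then \sum_i c (Some i) * B i t else 0).
  rewrite big_option; congr (_ + _); case: j => [t //|].
  by rewrite big1 // => i _; rewrite mulr0.
apply: (@basis_free_arr _ _ _ _ E); split=> [[i|]|theta Dtheta|c hc].
- exact: log_cone0_extend (DB i).
- exact: log_cone_euler.
- have [g hg] := log_cone_x0 Dtheta.
  pose theta' j := theta j - g * coordX K j.
  have theta'0 : theta' None = 0 by rewrite /theta' hg mulrC subrr.
  have /(log_coneE _ theta'0)/spanB[c hc] : log_cone A theta'.
    exact/log_coneB/log_cone_euler.
  exists (fun l => if l is Some i then c i else g) => j.
  rewrite sumE; apply/eqP; rewrite addrC -subr_eq; apply/eqP.
  by rewrite -/(theta' j); case: j.
- have c0 : c None = 0.
    have /eqP := hc None; rewrite sumE addr0 mulf_eq0.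
    by rewrite (negbTE (coordX_neq0 _ _)) orbF => /eqP.
  case=> // i; apply: (freeB (c \o Some)) => t.
  by have := hc (Some t); rewrite sumE c0 mul0r add0r.
Qed.

End Cone.

(** * Direct sums of modules over one ring *)

Lemma sum_tagged_with (R : nmodType) (I : finType) (T : I -> finType) (i : I)
    (F : {i : I & T i} -> R) :
  (forall p, tag p != i -> F p = 0) ->
  \sum_p F p = \sum_(t : T i) F (Tagged T t).
Proof.
move=> F0; have -> : \sum_p F p = \sum_j \sum_(t : T j) F (Tagged T t).
  by rewrite sig_big_dep; apply: eq_bigr => -[].
rewrite (bigD1 i) //= [X in _ + X]big1 ?addr0 // => j ji.
by rewrite big1 // => t _; apply: F0.
Qed.

Lemma untag_Tagged (R : Type) (I : eqType) (T : I -> Type) (x0 : R) i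
    (F : T i -> R) t : untag x0 F (Tagged T t) = F t.
Proof. by rewrite (untagE (u := Tagged T t) _ _ erefl). Qed.

Lemma liftFormE (K : fieldType) (I : finType) (T : I -> finType) i
    (a : {ffun T i -> K}) (p : {i : I & T i}) : liftForm a p = untag 0 a p.
Proof.
rewrite /liftForm; case: eqVneq => [e|ne]; first by rewrite (untagE _ _ e).
by rewrite untag_dflt.
Qed.

Section DirectSum.
Variables (S : comNzRingType) (I : finType) (T L : I -> finType).
Variables (D : forall i, (T i -> S) -> Prop) (B : forall i, L i -> T i -> S).
Hypothesis D0 : forall i, @D i (fun=> 0).
Hypothesis eqD : forall i u v, u =1 v -> @D i u -> @D i v.

(** The block-diagonal family: an entry is zero unless both tags agree, [untag] supplying the
    transport between fibres. *)
Definition dsum_basis (q : {i : I & L i}) (p : {i : I & T i}) : S :=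
  untag 0 (fun l => B l (tagged p)) q.

Lemma sum_dsum_basis (c : {i : I & L i} -> S) i (t : T i) :
  \sum_q c q * dsum_basis q (Tagged T t) = \sum_l c (Tagged L l) * B l t.
Proof.
rewrite (sum_tagged_with (i := i)) => [|q ne]; last first.
  by rewrite /dsum_basis untag_dflt ?mulr0.
by apply: eq_bigr => l _; rewrite /dsum_basis untag_Tagged.
Qed.

Lemma dsum_basisP :
  (forall i, module_basis (@D i) (@B i)) ->
  module_basis (fun theta => forall i, D (fun t : T i => theta (Tagged T t)))
    dsum_basis.
Proof.
move=> bB; split=> [[i l] j|theta Dtheta|c hc [i l]].
- have [ij|ne] := eqVneq i j; last first.
    by apply: eqD (D0 j) => t; rewrite /dsum_basis untag_dflt.
  subst j; have [DB _ _] := bB i; apply: eqD (DB l) => t.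
  by rewrite /dsum_basis untag_Tagged.
- have /fin_all_exists[c hc] : forall i, spans (@B i) (fun t => theta (Tagged T t)).
    by move=> i; have [_ spanB _] := bB i; apply: spanB.
  by exists (fun q => c (tag q) (tagged q)) => -[i t]; rewrite hc sum_dsum_basis.
- have [_ _ freeB] := bB i; apply: (freeB (fun l => c (Tagged L l))) => t.
  by rewrite -sum_dsum_basis.
Qed.

End DirectSum.

Lemma module_basis_ext (S : comNzRingType) (J : Type) (D D' : (J -> S) -> Prop)
    (L : finType) (B : L -> J -> S) :
  (forall theta, D theta <-> D' theta) -> module_basis D B -> module_basis D' B.
Proof.
by move=> DD' [DB spanB freeB]; split=> // [i|theta /DD'/spanB //]; apply/DD'.
Qed.

(** * The cone of a direct sum *)

Section ConeDirectSum.
Variables (K : fieldType) (I : finType) (T : I -> finType).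
Variable A : forall i, affArr K (T i).

(** [omap] fixes [None], so the homogenizing variables of all summands are identified with the
    single x_0, while the other variables go to their own block. *)
Definition cone_var i (k : 'I_#|{: option (T i)}|) : 'I_#|{: option {i : I & T i}}| :=
  enum_rank (omap (Tagged T) (enum_val k)).

Lemma cone_var_inj i : injective (@cone_var i).
Proof.
move=> k l /enum_rank_inj kl; apply: enum_val_inj.
case: (enum_val k) (enum_val l) kl => [x|] [y|] //= [] /eqP.
by rewrite eq_Tagged /= => /eqP ->.
Qed.

Lemma mrename_coneForm i (H : affHyp K (T i)) :
  mrename (@cone_var i) (linpoly (coneForm H)) = linpoly (coneForm (liftHyp H)).
Proof.
have renameE (j : option (T i)) :
    mrename (@cone_var i) (coordX K j) = coordX K (omap (Tagged T) j).
  by rewrite mrenameX /cone_var enum_rankK.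
rewrite /linpoly rmorph_sum !big_option /= mrenameZ renameE !ffunE.
congr (_ + _); rewrite (sum_tagged_with (i := i)) => [|p ne].
  apply: eq_bigr => t _; rewrite mrenameZ renameE !ffunE.
  by rewrite liftFormE untag_Tagged.
by rewrite !ffunE liftFormE untag_dflt ?scale0r.
Qed.

(** Each hyperplane of the sum comes from one summand, and its linear part involves only the
    coordinates of that block, so the conditions separate. This fails for D itself, whose x_0
    component is shared by all blocks. *)
Lemma log_cone0_dirsum theta :
  (forall i, log_along (A i) (fun H => ah_form H)
     (mrename (@cone_var i) \o (fun H => linpoly (coneForm H)))
     (fun t => theta (Tagged T t)))
  <-> log_cone0 (dirsum A) theta.
Proof.
have sumE i (H : affHyp K (T i)) :
    \sum_p ah_form (liftHyp H) p *: theta p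
    = \sum_t ah_form H t *: theta (Tagged T t).
  rewrite (sum_tagged_with (i := i)) => [|p ne].
    by apply: eq_bigr => t _; rewrite ffunE liftFormE untag_Tagged.
  by rewrite ffunE liftFormE untag_dflt ?scale0r.
split=> [h _ /flatten_mapP[i _ /mapP[H HA ->]]|h i H HA].
  by have [g hg] := h i H HA; exists g; rewrite sumE hg /= mrename_coneForm.
have [|g hg] := h (liftHyp H).
  by apply/flatten_mapP; exists i; rewrite ?mem_enum ?map_f.
by exists g; rewrite -sumE hg /= mrename_coneForm.
Qed.

Lemma cone_dirsum_free :
  (forall i, free_arr (cone (A i))) -> free_arr (cone (dirsum A)).
Proof.
move=> freeA.
have /fin_all_exists[L /fin_all_exists[B bB]] i := log_cone0_basis (freeA i).
apply: (cone_free_of_basis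
  (B := dsum_basis (fun i l t => mrename (@cone_var i) (B i l t)))).
(* It remains to extend each basis of D_0(cA_i) to the common ring and to place the results in
   blocks. *)
apply: module_basis_ext log_cone0_dirsum _.
apply: (dsum_basisP (D := fun i => log_along (A i) (fun H => ah_form H)
    (mrename (@cone_var i) \o fun H => linpoly (coneForm H))))
  => [i H _|i u v uv Du H HA|i].
- by exists 0; rewrite mulr0 big1 // => j _; rewrite scaler0.
- by have [g hg] := Du H HA; exists g; rewrite -hg; apply: eq_bigr => j _; rewrite uv.
- by apply: base_change_basis (bB i); apply: cone_var_inj.
Qed.

End ConeDirectSum.

Theorem mainTheorem10 (K : fieldType) (k : nat) (n : 'I_k -> nat)
  (A : forall i : 'I_k, affArr K 'I_(n i)) :
  (forall i, wf_affArr (A i)) ->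
  (forall i, free_arr (cone (A i))) ->
  free_arr (cone (dirsum A)).
Proof. by move=> _; apply: cone_dirsum_free. Qed.
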